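(* Let $A$ be a $*$-algebra, let $(\Omega^\bullet A,d,* )$ be a differential $*$-calculus on $A$, and let $J$ be an almost complex structure on it. Then for all $\xi\in\Omega^\bullet A$ and all $p,q\ge 0$: $$J(\xi^* )=(J\xi)^*\qquad\text{and}\qquad(\Omega^{p,q}A)^*=\Omega^{q,p}A .$$
   Context: All algebras are associative, unital, over $\mathbb{C}$, not necessarily commutative. A $*$-algebra is an algebra $A$ with a conjugate-linear map $a\mapsto a^*$ such that $a^{**}=a$ and $(ab)^*=b^*a^*$. The universal differential graded algebra of $A$ is the tensor algebra $\Omega^\bullet_{\rm univ}A=T_A(\Omega^1_{\rm univ}A)$, where $\Omega^1_{\rm univ}A=\ker(A\otimes A\to A)$ (kernel of multiplication), with the unique degree one superderivation $d$ ($d^2=0$) such that $da=1\otimes a-a\otimes 1$ for $a\in A$. A differential calculus on $A$ is a differential graded algebra $(\Omega^\bullet A,d)$ that is a quotient of $(\Omega^\bullet_{\rm univ}A,d)$ by a differential graded ideal whose degree-zero component is zero; so $\Omega^0A=A$ and $\Omega^nA$ is spanned by the elements $a_0\,da_1\wedge\cdots\wedge da_n$. The product is written $\wedge$ and is not assumed graded-commutative. A differential $*$-calculus $(\Omega^\bullet A,d,* )$ on a $*$-algebra $A$ is a differential calculus together with a conjugate-linear, grading-preserving involution $\xi\mapsto\xi^*$ on $\Omega^\bullet A$ extending $*$ on $A$, with $(d\xi)^*=d(\xi^* )$ and $(\xi\wedge\eta)^*=(-1)^{|\xi||\eta|}\eta^*\wedge\xi^*$ for homogeneous $\xi,\eta$.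 An almost complex structure on $(\Omega^\bullet A,d,* )$ is a degree zero $\mathbb{C}$-linear derivation $J:\Omega^\bullet A\to\Omega^\bullet A$ (so $J(\xi\wedge\eta)=J\xi\wedge\eta+\xi\wedge J\eta$) such that $J=0$ on $A$, $J^2=-1$ on $\Omega^1A$, and $J(\xi^* )=(J\xi)^*$ for $\xi\in\Omega^1A$. For $p,q\ge 0$, $\Omega^{p,q}A=\{\xi\in\Omega^{p+q}A: J\xi=(p-q)\mathrm{i}\,\xi\}$. *)

(* Defs.v *)
From HB Require Import structures.
From mathcomp Require Import all_boot all_order all_algebra.
From mathcomp Require Import boolp classical_sets.

Set Implicit Arguments.
Unset Strict Implicit.
Unset Printing Implicit Defensive.

Import Order.TTheory GRing.Theory Num.Theory.
Local Open Scope ring_scope.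
Local Open Scope quotient_scope.

Section LinearFacts.
Variables (K : pzRingType) (U V : lmodType K) (f : U -> V) (lin_f : linear f).

Lemma linear_add x y : f (x + y) = f x + f y.
Proof. by rewrite -[x]scale1r lin_f !scale1r. Qed.

Lemma linear_scale k x : f (k *: x) = k *: f x.
Proof. exact: scalable_linear. Qed.

Lemma linear_zero : f 0 = 0.
Proof. by rewrite -(scale0r 0) linear_scale scale0r. Qed.

Lemma linear_opp x : f (- x) = - f x.
Proof. by rewrite -scaleN1r linear_scale scaleN1r. Qed.

End LinearFacts.

(* The tensor product of two modules: formal sums of pairs, two of them
    being identified when every bilinear map takes the same value on both. *)

Section TensorProduct.
Variables (K : comNzRingType) (V W : lmodType K).

Definition bilinear_map (Z : lmodType K) (b : V -> W -> Z) : Prop :=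
  (forall w, linear (b^~ w)) /\ (forall v, linear (b v)).

Definition tens_eval (Z : lmodType K) (b : V -> W -> Z) (s : seq (V * W)) : Z :=
  \sum_(x <- s) b x.1 x.2.

Definition tens_rel (s t : seq (V * W)) : bool :=
  `[< forall (Z : lmodType K) (b : V -> W -> Z),
        bilinear_map b -> tens_eval b s = tens_eval b t >].

Lemma tens_rel_equiv : equiv_class_of tens_rel.
Proof.
split=> [s|s t|t s u /asboolP H1 /asboolP H2]; first exact/asboolP.
- by apply/asboolP/asboolP => H Z b hb; rewrite H.
- by apply/asboolP => Z b hb; rewrite H1 // H2.
Qed.

Canonical tens_equiv := EquivRelPack tens_rel_equiv.

Definition tens := {eq_quot tens_equiv}.
HB.instance Definition _ := Choice.on tens.

Definition tpair (v : V) (w : W) : tens := \pi_(tens) [:: (v, w)].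

Definition tens_lift (Z : lmodType K) (b : V -> W -> Z) (x : tens) : Z :=
  tens_eval b (repr x).

Lemma tens_lift_pi (Z : lmodType K) (b : V -> W -> Z) s :
  bilinear_map b -> tens_lift b (\pi_(tens) s) = tens_eval b s.
Proof.
move=> hb; rewrite /tens_lift.
have /eqmodP/asboolP : repr (\pi_(tens) s) = s %[mod tens] by rewrite reprK.
exact.
Qed.

Lemma tens_ext (x y : tens) :
  (forall (Z : lmodType K) (b : V -> W -> Z), bilinear_map b ->
     tens_lift b x = tens_lift b y) -> x = y.
Proof. by move=> H; rewrite -[x]reprK -[y]reprK; apply/eqmodP/asboolP. Qed.

Definition tens0 : tens := \pi_(tens) [::].
Definition tens_add (x y : tens) : tens := \pi_(tens) (repr x ++ repr y).
Definition tens_scale (k : K) (x : tens) : tens :=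
  \pi_(tens) [seq (k *: u.1, u.2) | u <- repr x].
Definition tens_opp (x : tens) : tens := tens_scale (-1) x.

Section Lift.
Variables (Z : lmodType K) (b : V -> W -> Z) (hb : bilinear_map b).

Let blZ (k : K) v w : b (k *: v) w = k *: b v w.
Proof. exact: (scalable_linear (hb.1 w) k v). Qed.

Lemma tens_lift0 : tens_lift b tens0 = 0.
Proof. by rewrite tens_lift_pi // /tens_eval big_nil. Qed.

Lemma tens_liftD x y : tens_lift b (tens_add x y) = tens_lift b x + tens_lift b y.
Proof. by rewrite tens_lift_pi // /tens_eval big_cat. Qed.

Lemma tens_liftZ k x : tens_lift b (tens_scale k x) = k *: tens_lift b x.
Proof.
rewrite tens_lift_pi // /tens_eval big_map scaler_sumr.
by apply: eq_bigr => u _; rewrite blZ.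
Qed.

Lemma tens_lift_tpair v w : tens_lift b (tpair v w) = b v w.
Proof. by rewrite tens_lift_pi // /tens_eval big_seq1. Qed.

End Lift.

Fact tens_addA : associative tens_add.
Proof. by move=> x y z; apply: tens_ext => Z b hb; rewrite !tens_liftD // addrA. Qed.
Fact tens_addC : commutative tens_add.
Proof. by move=> x y; apply: tens_ext => Z b hb; rewrite !tens_liftD // addrC. Qed.
Fact tens_add0 : left_id tens0 tens_add.
Proof. by move=> x; apply: tens_ext => Z b hb; rewrite tens_liftD // tens_lift0 // add0r. Qed.
Fact tens_addN : left_inverse tens0 tens_opp tens_add.
Proof.
move=> x; apply: tens_ext => Z b hb.
by rewrite tens_liftD // tens_lift0 // tens_liftZ // scaleN1r addNr.
Qed.

HB.instance Definition _ :=
  GRing.isZmodule.Build tens tens_addA tens_addC tens_add0 tens_addN.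

Fact tens_scaleA k l x : tens_scale k (tens_scale l x) = tens_scale (k * l) x.
Proof. by apply: tens_ext => Z b hb; rewrite !tens_liftZ // scalerA. Qed.
Fact tens_scale1 : left_id 1 tens_scale.
Proof. by move=> x; apply: tens_ext => Z b hb; rewrite tens_liftZ // scale1r. Qed.
Fact tens_scaleDr : right_distributive tens_scale +%R.
Proof.
by move=> k x y; apply: tens_ext => Z b hb; rewrite !(tens_liftZ, tens_liftD) // scalerDr.
Qed.
Fact tens_scaleDl x : {morph tens_scale^~ x : k l / k + l}.
Proof.
by move=> k l; apply: tens_ext => Z b hb; rewrite !(tens_liftZ, tens_liftD) // scalerDl.
Qed.

HB.instance Definition _ := GRing.Zmodule_isLmodule.Build K tens
  tens_scaleA tens_scale1 tens_scaleDr tens_scaleDl.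

Lemma tens_lift_linear (Z : lmodType K) (b : V -> W -> Z) :
  bilinear_map b -> linear (tens_lift b).
Proof. by move=> hb k x y; rewrite tens_liftD // tens_liftZ. Qed.

Lemma tpair_bilinear : bilinear_map tpair.
Proof.
split=> [w k u v|v k u w]; apply: tens_ext => Z b hb;
  rewrite tens_lift_linear // !tens_lift_tpair //; [exact: hb.1|exact: hb.2].
Qed.

Lemma tens_ind (P : tens -> Prop) :
  P 0 -> (forall v w, P (tpair v w)) -> (forall x y, P x -> P y -> P (x + y)) ->
  forall x, P x.
Proof.
move=> P0 Pp PD x; rewrite -[x]reprK.
elim: (repr x) => [|[v w] s IH] //.
have -> : \pi_(tens) ((v, w) :: s) = tpair v w + \pi_(tens) s.
  apply: tens_ext => Z b hb; rewrite tens_liftD // !tens_lift_pi //.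
  by rewrite /tens_eval big_seq1 big_cons.
by apply: PD => //; apply: Pp.
Qed.

End TensorProduct.

(* The tensor algebra of an [A]-bimodule [M] (left action [la], right action
    [ra]): formal sums of words in the letters [A + M], two of them being
    identified when they take the same value in every algebra [B] equipped with
    an algebra morphism [A -> B] and a bimodule map [M -> B]. *)

Section TensorAlgebra.
Variables (K : comNzRingType) (A : algType K) (M : lmodType K).
Variables (la : A -> M -> M) (ra : M -> A -> M).

Record tmodel (B : algType K) (f : A -> B) (g : M -> B) : Prop := TModel {
  tmodel_f_linear : linear f;
  tmodel_f1 : f 1 = 1;
  tmodel_fM : forall a b, f (a * b) = f a * f b;
  tmodel_g_linear : linear g;
  tmodel_gl : forall a m, g (la a m) = f a * g m;
  tmodel_gr : forall m a, g (ra m a) = g m * f a }.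

Definition letter_eval (B : algType K) (f : A -> B) (g : M -> B) (l : A + M) : B :=
  match l with inl a => f a | inr m => g m end.

Definition word_eval (B : algType K) (f : A -> B) (g : M -> B) (w : seq (A + M)) : B :=
  \prod_(l <- w) letter_eval f g l.

Definition talg_eval (B : algType K) (f : A -> B) (g : M -> B)
    (s : seq (seq (A + M))) : B :=
  \sum_(w <- s) word_eval f g w.

Definition talg_rel (s t : seq (seq (A + M))) : bool :=
  `[< forall (B : algType K) (f : A -> B) (g : M -> B),
        tmodel f g -> talg_eval f g s = talg_eval f g t >].

Lemma talg_rel_equiv : equiv_class_of talg_rel.
Proof.
split=> [s|s t|t s u /asboolP H1 /asboolP H2]; first exact/asboolP.
- by apply/asboolP/asboolP => H B f g h; rewrite H.
- by apply/asboolP => B f g h; rewrite H1 // H2.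
Qed.

Canonical talg_equiv := EquivRelPack talg_rel_equiv.

Definition talg := {eq_quot talg_equiv}.
HB.instance Definition _ := Choice.on talg.

Definition talg_lift (B : algType K) (f : A -> B) (g : M -> B) (x : talg) : B :=
  talg_eval f g (repr x).

Lemma talg_lift_pi (B : algType K) (f : A -> B) (g : M -> B) s :
  tmodel f g -> talg_lift f g (\pi_(talg) s) = talg_eval f g s.
Proof.
move=> h; rewrite /talg_lift.
have /eqmodP/asboolP : repr (\pi_(talg) s) = s %[mod talg] by rewrite reprK.
exact.
Qed.

Lemma talg_ext (x y : talg) :
  (forall (B : algType K) (f : A -> B) (g : M -> B), tmodel f g ->
     talg_lift f g x = talg_lift f g y) -> x = y.
Proof. by move=> H; rewrite -[x]reprK -[y]reprK; apply/eqmodP/asboolP. Qed.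

Definition talg0 : talg := \pi_(talg) [::].
Definition talg1 : talg := \pi_(talg) [:: [::]].
Definition talg_add (x y : talg) : talg := \pi_(talg) (repr x ++ repr y).
Definition talg_scale (k : K) (x : talg) : talg :=
  \pi_(talg) [seq inl k%:A :: w | w <- repr x].
Definition talg_opp (x : talg) : talg := talg_scale (-1) x.
Definition talg_mul (x y : talg) : talg :=
  \pi_(talg) [seq u ++ v | u <- repr x, v <- repr y].

Section Lift.
Variables (B : algType K) (f : A -> B) (g : M -> B) (h : tmodel f g).

Lemma tmodel_fA (k : K) : f k%:A = k%:A.
Proof. by rewrite (linear_scale (tmodel_f_linear h)) (tmodel_f1 h). Qed.

Lemma word_eval_cat u v : word_eval f g (u ++ v) = word_eval f g u * word_eval f g v.
Proof. by rewrite /word_eval big_cat. Qed.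

Lemma word_eval_cons l w : word_eval f g (l :: w) = letter_eval f g l * word_eval f g w.
Proof. by rewrite /word_eval big_cons. Qed.

Lemma talg_eval_scale k s :
  talg_eval f g [seq inl k%:A :: w | w <- s] = k *: talg_eval f g s.
Proof.
rewrite /talg_eval big_map scaler_sumr; apply: eq_bigr => w _.
by rewrite word_eval_cons /= tmodel_fA -scalerAl mul1r.
Qed.

Lemma talg_eval_mul s t :
  talg_eval f g [seq u ++ v | u <- s, v <- t] = talg_eval f g s * talg_eval f g t.
Proof.
rewrite /talg_eval big_allpairs_dep mulr_suml; apply: eq_bigr => u _.
by rewrite mulr_sumr; apply: eq_bigr => v _; rewrite word_eval_cat.
Qed.

Lemma talg_lift0 : talg_lift f g talg0 = 0.
Proof. by rewrite talg_lift_pi // /talg_eval big_nil. Qed.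

Lemma talg_lift1 : talg_lift f g talg1 = 1.
Proof. by rewrite talg_lift_pi // /talg_eval big_seq1 /word_eval big_nil. Qed.

Lemma talg_liftD x y : talg_lift f g (talg_add x y) = talg_lift f g x + talg_lift f g y.
Proof. by rewrite talg_lift_pi // /talg_eval big_cat. Qed.

Lemma talg_liftZ k x : talg_lift f g (talg_scale k x) = k *: talg_lift f g x.
Proof. by rewrite talg_lift_pi // talg_eval_scale. Qed.

Lemma talg_liftN x : talg_lift f g (talg_opp x) = - talg_lift f g x.
Proof. by rewrite talg_liftZ scaleN1r. Qed.

Lemma talg_liftM x y : talg_lift f g (talg_mul x y) = talg_lift f g x * talg_lift f g y.
Proof. by rewrite talg_lift_pi // talg_eval_mul. Qed.

End Lift.

Ltac talg_ax :=
  hnf; intros; apply: talg_ext;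
  let B := fresh in let f := fresh in let g := fresh in let h := fresh in
  intros B f g h;
  rewrite !(talg_liftN h, talg_liftD h, talg_liftM h, talg_liftZ h, talg_lift0 h,
            talg_lift1 h).

Fact talg_addA : associative talg_add. Proof. by talg_ax; rewrite addrA. Qed.
Fact talg_addC : commutative talg_add. Proof. by talg_ax; rewrite addrC. Qed.
Fact talg_add0 : left_id talg0 talg_add. Proof. by talg_ax; rewrite add0r. Qed.
Fact talg_addN : left_inverse talg0 talg_opp talg_add.
Proof. by talg_ax; rewrite addNr. Qed.

HB.instance Definition _ :=
  GRing.isZmodule.Build talg talg_addA talg_addC talg_add0 talg_addN.

Fact talg_mulA : associative talg_mul. Proof. by talg_ax; rewrite mulrA. Qed.
Fact talg_mul1l : left_id talg1 talg_mul. Proof. by talg_ax; rewrite mul1r. Qed.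
Fact talg_mul1r : right_id talg1 talg_mul. Proof. by talg_ax; rewrite mulr1. Qed.
Fact talg_mulDl : left_distributive talg_mul +%R.
Proof. by talg_ax; rewrite mulrDl. Qed.
Fact talg_mulDr : right_distributive talg_mul +%R.
Proof. by talg_ax; rewrite mulrDr. Qed.

Lemma tmodel_id0 : tmodel id (fun _ : M => 0 : A).
Proof.
split=> // [k x y|a m|m a]; by rewrite ?scaler0 ?addr0 ?mulr0 ?mul0r.
Qed.

Fact talg_1_neq0 : talg1 != 0.
Proof.
apply/eqP => /(congr1 (talg_lift id (fun _ : M => 0 : A))).
rewrite (talg_lift1 tmodel_id0) (talg_lift0 tmodel_id0) => /eqP.
by rewrite oner_eq0.
Qed.

HB.instance Definition _ := GRing.Zmodule_isNzRing.Build talg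
  talg_mulA talg_mul1l talg_mul1r talg_mulDl talg_mulDr talg_1_neq0.

Fact talg_scaleA k l x : talg_scale k (talg_scale l x) = talg_scale (k * l) x.
Proof. by talg_ax; rewrite scalerA. Qed.
Fact talg_scale1 : left_id 1 talg_scale. Proof. by talg_ax; rewrite scale1r. Qed.
Fact talg_scaleDr : right_distributive talg_scale +%R.
Proof. by talg_ax; rewrite scalerDr. Qed.
Fact talg_scaleDl x : {morph talg_scale^~ x : k l / k + l}.
Proof. by talg_ax; rewrite scalerDl. Qed.

HB.instance Definition _ := GRing.Zmodule_isLmodule.Build K talg
  talg_scaleA talg_scale1 talg_scaleDr talg_scaleDl.

Fact talg_scalerAl (k : K) (x y : talg) : k *: (x * y) = (k *: x) * y.
Proof. by talg_ax; rewrite scalerAl. Qed.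
HB.instance Definition _ := GRing.Lmodule_isLalgebra.Build K talg talg_scalerAl.

Fact talg_scalerAr (k : K) (x y : talg) : k *: (x * y) = x * (k *: y).
Proof. by talg_ax; rewrite scalerAr. Qed.
HB.instance Definition _ := GRing.Lalgebra_isAlgebra.Build K talg talg_scalerAr.

Definition talg_in0 (a : A) : talg := \pi_(talg) [:: [:: inl a]].
Definition talg_in1 (m : M) : talg := \pi_(talg) [:: [:: inr m]].

Section LiftIn.
Variables (B : algType K) (f : A -> B) (g : M -> B) (h : tmodel f g).

Lemma talg_lift_in0 a : talg_lift f g (talg_in0 a) = f a.
Proof. by rewrite talg_lift_pi // /talg_eval big_seq1 /word_eval big_seq1. Qed.

Lemma talg_lift_in1 m : talg_lift f g (talg_in1 m) = g m.
Proof. by rewrite talg_lift_pi // /talg_eval big_seq1 /word_eval big_seq1. Qed.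

Lemma talg_lift_linear : linear (talg_lift f g).
Proof. by move=> k x y; rewrite (talg_liftD h) (talg_liftZ h). Qed.

Lemma talg_lift_mul x y : talg_lift f g (x * y) = talg_lift f g x * talg_lift f g y.
Proof. exact: talg_liftM. Qed.

Lemma talg_lift_one : talg_lift f g 1 = 1.
Proof. exact: talg_lift1. Qed.

End LiftIn.

Lemma tmodel_in : tmodel talg_in0 talg_in1.
Proof.
split=> [k x y||a b|k x y|a m|m a]; apply: talg_ext => B f g h;
  rewrite ?talg_lift_linear ?talg_lift_mul ?talg_lift_one // !(talg_lift_in0 h, talg_lift_in1 h).
- exact: tmodel_f_linear h k x y.
- exact: tmodel_f1 h.
- exact: tmodel_fM h a b.
- exact: tmodel_g_linear h k x y.
- exact: tmodel_gl h a m.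
- exact: tmodel_gr h m a.
Qed.

Lemma talg_piE s : \pi_(talg) s = talg_eval talg_in0 talg_in1 s.
Proof.
apply: talg_ext => B f g h.
have lift_sum (r : seq (seq (A + M))) :
    talg_lift f g (talg_eval talg_in0 talg_in1 r) = talg_eval f g r.
  rewrite /talg_eval; elim: r => [|w r IH]; first by rewrite !big_nil (talg_lift0 h).
  rewrite !big_cons (talg_liftD h) IH; congr (_ + _).
  elim: w => [|l w IHw]; first by rewrite /word_eval !big_nil (talg_lift1 h).
  rewrite !word_eval_cons talg_lift_mul // IHw; congr (_ * _).
  by case: l => [a|m] /=; rewrite (talg_lift_in0 h, talg_lift_in1 h).
by rewrite lift_sum talg_lift_pi.
Qed.

Lemma talg_lift_word (B : algType K) (f : A -> B) (g : M -> B) w : tmodel f g ->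
  talg_lift f g (word_eval talg_in0 talg_in1 w) = word_eval f g w.
Proof.
move=> h; have := talg_piE [:: w]; rewrite /talg_eval big_seq1 => <-.
by rewrite talg_lift_pi // /talg_eval big_seq1.
Qed.

(* The component of degree [n] is spanned by the words with [n] letters in [M]. *)
Definition word_deg (w : seq (A + M)) : nat :=
  count (fun l => if l is inr _ then true else false) w.

Definition talg_gr (n : nat) : set talg := [set x |
  exists2 s : seq (seq (A + M)), all (fun w => word_deg w == n) s & x = \pi_(talg) s].

Lemma talg_gr_word w : talg_gr (word_deg w) (word_eval talg_in0 talg_in1 w).
Proof.
exists [:: w]; first by rewrite /= eqxx.
by rewrite talg_piE /talg_eval big_seq1.
Qed.

Lemma talg_gr_in0 a : talg_gr 0 (talg_in0 a). Proof. by exists [:: [:: inl a]]. Qed.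
Lemma talg_gr_in1 m : talg_gr 1 (talg_in1 m). Proof. by exists [:: [:: inr m]]. Qed.

Lemma talg_gr0 n : talg_gr n 0.
Proof. by exists [::]. Qed.

Lemma talg_grP n k x y : talg_gr n x -> talg_gr n y -> talg_gr n (k *: x + y).
Proof.
move=> [s hs ->] [t ht ->]; exists ([seq inl k%:A :: w | w <- s] ++ t).
  by rewrite all_cat all_map ht andbT; apply: sub_all hs.
rewrite !talg_piE [in RHS]/talg_eval big_cat /= -!/(talg_eval _ _ _).
by rewrite talg_eval_scale //; apply: tmodel_in.
Qed.

Lemma talg_grD n x y : talg_gr n x -> talg_gr n y -> talg_gr n (x + y).
Proof. by move=> hx hy; rewrite -[x]scale1r; apply: talg_grP. Qed.

Lemma talg_grZ n k x : talg_gr n x -> talg_gr n (k *: x).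
Proof. by move=> hx; rewrite -[_ *: _]addr0; apply: talg_grP => //; apply: talg_gr0. Qed.

Lemma talg_gr1 : talg_gr 0 1.
Proof. by exists [:: [::]]. Qed.

Lemma talg_grM m n x y : talg_gr m x -> talg_gr n y -> talg_gr (m + n) (x * y).
Proof.
move=> [s /allP hs ->] [t /allP ht ->]; exists [seq u ++ v | u <- s, v <- t].
  apply/allP => w /allpairsP[[u v] /= [us vt ->]].
  by rewrite /word_deg count_cat -!/(word_deg _) (eqP (hs _ us)) (eqP (ht _ vt)).
by rewrite !talg_piE talg_eval_mul.
Qed.

Lemma talg_gr_ind n (P : talg -> Prop) :
  P 0 -> (forall x y, P x -> P y -> P (x + y)) ->
  (forall w, word_deg w = n -> P (word_eval talg_in0 talg_in1 w)) ->
  forall x, talg_gr n x -> P x.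
Proof.
move=> P0 PD Pw x [s hs ->]; rewrite talg_piE /talg_eval.
elim: s hs => [|w s IH] /=; first by rewrite big_nil.
by move=> /andP[/eqP hw hs]; rewrite big_cons; apply: PD; [apply: Pw|apply: IH].
Qed.

Lemma talg_ind (P : talg -> Prop) :
  P 0 -> (forall x y, P x -> P y -> P (x + y)) ->
  (forall w, P (word_eval talg_in0 talg_in1 w)) -> forall x, P x.
Proof.
move=> P0 PD Pw x; rewrite -[x]reprK talg_piE /talg_eval.
elim: (repr x) => [|w s IH] /=; first by rewrite big_nil.
by rewrite big_cons; apply: PD.
Qed.

Lemma talg_gr_sum x : exists n (c : nat -> talg),
  (forall i, talg_gr i (c i)) /\ x = \sum_(i < n) c i.
Proof.
move: x; apply: talg_ind => [|x y [m [c [hc ->]]] [n [e [he ->]]]|w].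
- by exists 0, (fun=> 0); split; [move=> i; apply: talg_gr0|rewrite big_ord0].
- exists (maxn m n), (fun i => (if (i < m)%N then c i else 0)
                             + (if (i < n)%N then e i else 0)); split.
    by move=> i; apply: talg_grD; case: ifP => _ //; apply: talg_gr0.
  rewrite big_split /= -!big_mkcond /=.
  rewrite (big_ord_widen _ c (leq_maxl m n)) (big_ord_widen _ e (leq_maxr m n)).
  by congr (_ + _).
- exists (word_deg w).+1, (fun i => if i == word_deg w
      then word_eval talg_in0 talg_in1 w else 0); split.
    by move=> i; case: eqP => [->|_]; [apply: talg_gr_word|apply: talg_gr0].
  rewrite big_ord_recr /= eqxx big1 ?add0r // => i _.
  by rewrite ltn_eqF.
Qed.

End TensorAlgebra.

(* Components of different degrees are independent: they are eigenspaces of the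
   automorphism of the tensor algebra that doubles the letters in [M]. *)
Section TensorAlgebraGrading.
Variables (K : numFieldType) (A : algType K) (M : lmodType K).
Variables (la : A -> M -> M) (ra : M -> A -> M).
Local Notation T := (talg la ra).
Local Notation in0 := (@talg_in0 K A M la ra).
Local Notation in1 := (@talg_in1 K A M la ra).

Let dbl (m : M) : T := 2%:R *: in1 m.

Let dbl_model : tmodel la ra in0 dbl.
Proof.
have h := tmodel_in la ra; split=> [||||a m|m a]; rewrite /dbl.
- exact: tmodel_f_linear h.
- exact: tmodel_f1 h.
- exact: tmodel_fM h.
- move=> k x y; rewrite (tmodel_g_linear h) scalerDr !scalerA.
  by rewrite [2%:R * k]mulrC.
- by rewrite (tmodel_gl h) scalerAr.
- by rewrite (tmodel_gr h) scalerAl.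
Qed.

Let dbl_gr n x : talg_gr n x -> talg_lift in0 dbl x = (2%:R ^+ n : K) *: x.
Proof.
move: x; apply: talg_gr_ind => [|x y IHx IHy|w <-].
- by rewrite (talg_lift0 dbl_model) scaler0.
- by rewrite (talg_liftD dbl_model) IHx IHy scalerDr.
rewrite talg_lift_word //; elim: w => [|l w IH].
  by rewrite /word_eval !big_nil expr0 scale1r.
rewrite !word_eval_cons IH -scalerAr /word_deg /=.
by case: l => [a|m] //=; rewrite /dbl -scalerAl scalerA exprS mulrC.
Qed.

Lemma talg_gr_indep n (c : nat -> T) : (forall i, talg_gr i (c i)) ->
  \sum_(i < n) c i = 0 -> forall i, (i < n)%N -> c i = 0.
Proof.
elim: n c => // n IH c hc hsum.
have H0 : \sum_(i < n.+1) ((2%:R ^+ i - 2%:R ^+ n : K) *: c i) = 0.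
  have : \sum_(i < n.+1) ((2%:R ^+ i : K) *: c i) = 0.
    have : talg_lift in0 dbl (\sum_(i < n.+1) c i) = 0.
      by rewrite hsum (talg_lift0 dbl_model).
    have lift_sum (r : seq 'I_n.+1) : talg_lift in0 dbl (\sum_(i <- r) c i)
        = \sum_(i <- r) (2%:R ^+ i : K) *: c i.
      elim: r => [|j r IHr]; first by rewrite !big_nil (talg_lift0 dbl_model).
      by rewrite !big_cons (talg_liftD dbl_model) IHr (dbl_gr (hc j)).
    by rewrite lift_sum.
  under [X in _ -> X = _]eq_bigr do rewrite scalerBl.
  by rewrite sumrB -scaler_sumr hsum scaler0 subr0.
have hlt i : (i < n)%N -> c i = 0.
  move=> lt_in; have : (2%:R ^+ i - 2%:R ^+ n : K) *: c i = 0.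
    apply: (IH (fun i => (2%:R ^+ i - 2%:R ^+ n : K) *: c i)) => //.
      by move=> j; apply: talg_grZ.
    by move: H0; rewrite big_ord_recr /= subrr scale0r addr0.
  move=> /(congr1 (fun x => (2%:R ^+ i - 2%:R ^+ n : K)^-1 *: x)).
  rewrite scalerA scaler0 mulVf ?scale1r // subr_eq0.
  by rewrite -!natrX eqr_nat eqn_exp2l // ltn_eqF.
move=> i; rewrite ltnS leq_eqVlt => /orP[/eqP->|]; last exact: hlt.
move: hsum; rewrite big_ord_recr /= big1 ?add0r // => j _; exact: hlt.
Qed.

End TensorAlgebraGrading.

(* The grading is internal: the sets [dga_gr n] are subspaces of the total
   algebra, of which it is the direct sum ([dga_gr_sum], [dga_gr_indep]). *)
Record dga (K : comNzRingType) := Dga {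
  dga_alg :> algType K;
  dga_gr : nat -> set dga_alg;
  dga_d : dga_alg -> dga_alg;
  dga_gr0 : forall n, dga_gr n 0;
  dga_grP : forall n k x y, dga_gr n x -> dga_gr n y -> dga_gr n (k *: x + y);
  dga_gr1 : dga_gr 0 1;
  dga_grM : forall m n x y, dga_gr m x -> dga_gr n y -> dga_gr (m + n) (x * y);
  dga_gr_sum : forall x, exists n (c : nat -> dga_alg),
    (forall i, dga_gr i (c i)) /\ x = \sum_(i < n) c i;
  dga_gr_indep : forall n (c : nat -> dga_alg), (forall i, dga_gr i (c i)) ->
    \sum_(i < n) c i = 0 -> forall i, (i < n)%N -> c i = 0;
  dga_d_linear : linear dga_d;
  dga_d_gr : forall n x, dga_gr n x -> dga_gr n.+1 (dga_d x);
  dga_d_leibniz : forall n x y, dga_gr n x ->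
    dga_d (x * y) = dga_d x * y + (-1) ^+ n * (x * dga_d y);
  dga_d_d : forall x, dga_d (dga_d x) = 0 }.

Record dga_morphism (K : comNzRingType) (U V : dga K) (f : U -> V) : Prop :=
  DgaMorphism {
    dga_morphism_linear : linear f;
    dga_morphism1 : f 1 = 1;
    dga_morphismM : forall x y, f (x * y) = f x * f y;
    dga_morphism_gr : forall n x, dga_gr n x -> dga_gr n (f x);
    dga_morphism_d : forall x, f (dga_d x) = dga_d (f x) }.

(* The algebra of matrices [[p, q], [0, r]] over [B], written [(p, q, r)].
    For a superderivation [d] with parity automorphism [s], the map
    [x |-> (s x, d x, x)] is an algebra morphism; this is how [d] is constructed
    on a tensor algebra. *)

Section Triangular.
Variables (K : comNzRingType) (B : algType K).

Definition tri : Type := (B * B * B)%type.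
HB.instance Definition _ := GRing.Lmodule.copy tri (B * B * B)%type.

Definition tri1 : tri := (1, 0, 1).
Definition tri_mul (x y : tri) : tri :=
  (x.1.1 * y.1.1, x.1.1 * y.1.2 + x.1.2 * y.2, x.2 * y.2).

Lemma tri_ext (x y : tri) : x.1.1 = y.1.1 -> x.1.2 = y.1.2 -> x.2 = y.2 -> x = y.
Proof. by case: x y => [[a b] c] [[a' b'] c'] /= -> -> ->. Qed.

Fact tri_mulA : associative tri_mul.
Proof.
move=> [[a b] c] [[a' b'] c'] [[a'' b''] c'']; rewrite /tri_mul /=.
by rewrite !mulrA mulrDr mulrDl !mulrA addrA.
Qed.
Fact tri_mul1l : left_id tri1 tri_mul.
Proof. by move=> [[a b] c]; rewrite /tri_mul /= !mul1r mul0r addr0. Qed.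
Fact tri_mul1r : right_id tri1 tri_mul.
Proof. by move=> [[a b] c]; rewrite /tri_mul /= !mulr1 mulr0 add0r. Qed.
Fact tri_mulDl : left_distributive tri_mul +%R.
Proof.
move=> [[a b] c] [[a' b'] c'] [[a'' b''] c'']; rewrite /tri_mul /=.
by congr (_, _, _); rewrite /= ?mulrDl // addrACA.
Qed.
Fact tri_mulDr : right_distributive tri_mul +%R.
Proof.
move=> [[a b] c] [[a' b'] c'] [[a'' b''] c'']; rewrite /tri_mul /=.
by congr (_, _, _); rewrite /= ?mulrDr // addrACA.
Qed.
Fact tri_1_neq0 : tri1 != 0.
Proof. by apply/eqP => /(congr1 (fun x : tri => x.2)) /eqP /=; rewrite oner_eq0. Qed.
HB.instance Definition _ := GRing.Zmodule_isNzRing.Build tri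
  tri_mulA tri_mul1l tri_mul1r tri_mulDl tri_mulDr tri_1_neq0.

Fact tri_scalerAl (k : K) (x y : tri) : k *: (x * y) = (k *: x : tri) * y.
Proof.
by apply: tri_ext; rewrite /= ?scalerDr !scalerAl.
Qed.
HB.instance Definition _ := GRing.Lmodule_isLalgebra.Build K tri tri_scalerAl.
Fact tri_scalerAr (k : K) (x y : tri) : k *: (x * y) = x * (k *: y : tri).
Proof.
by apply: tri_ext; rewrite /= ?scalerDr !scalerAr.
Qed.
HB.instance Definition _ := GRing.Lalgebra_isAlgebra.Build K tri tri_scalerAr.

End Triangular.

Section Universal.
Variables (K : numFieldType) (A : algType K).

Lemma mul_bilinear : bilinear_map ( *%R : A -> A -> A).
Proof.
split=> [w k u v|v k u w]; first by rewrite mulrDl scalerAl.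
by rewrite mulrDr scalerAr.
Qed.

Definition tens_mul : tens A A -> A := tens_lift *%R.

Definition univ1_pred : {pred tens A A} := [pred x | tens_mul x == 0].
Fact univ1_submod_closed : submod_closed univ1_pred.
Proof.
have lin := tens_lift_linear mul_bilinear.
split=> [|k x y]; rewrite !inE /tens_mul; first by rewrite (tens_lift0 mul_bilinear).
by move=> /eqP hx /eqP hy; rewrite lin hx hy scaler0 addr0.
Qed.
HB.instance Definition _ :=
  GRing.isSubmodClosed.Build K (tens A A) univ1_pred univ1_submod_closed.

(* [Omega^1_univ A], the kernel of the multiplication of [A (x) A]. *)
Record univ1 := Univ1 { univ1_val :> tens A A; univ1P : univ1_val \in univ1_pred }.
HB.instance Definition _ := [isSub for univ1_val].
HB.instance Definition _ := [Choice of univ1 by <:].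
HB.instance Definition _ := [SubChoice_isSubLmodule of univ1 by <:].

Fact tens_la_bilinear (a : A) : bilinear_map (fun u v : A => tpair (a * u) v).
Proof.
split=> [w k u v|v k u w]; last exact: (tpair_bilinear A A).2.
by rewrite mulrDr -scalerAr (tpair_bilinear A A).1.
Qed.
Fact tens_ra_bilinear (a : A) : bilinear_map (fun u v : A => tpair u (v * a)).
Proof.
split=> [w k u v|v k u w]; first exact: (tpair_bilinear A A).1.
by rewrite mulrDl -scalerAl (tpair_bilinear A A).2.
Qed.

Definition tens_la (a : A) (x : tens A A) : tens A A :=
  tens_lift (fun u v => tpair (a * u) v) x.
Definition tens_ra (x : tens A A) (a : A) : tens A A :=
  tens_lift (fun u v => tpair u (v * a)) x.

Lemma tens_mul_la a x : tens_mul (tens_la a x) = a * tens_mul x.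
Proof.
have hb := mul_bilinear; have hl := tens_la_bilinear a.
elim/tens_ind: x => [|u v|x y IHx IHy]; rewrite /tens_mul /tens_la.
- by rewrite (tens_lift0 hl) !(tens_lift0 hb) mulr0.
- by rewrite (tens_lift_tpair hl) !(tens_lift_tpair hb) mulrA.
- by rewrite (tens_liftD hl) !(tens_liftD hb) mulrDr -IHx -IHy.
Qed.

Lemma tens_mul_ra a x : tens_mul (tens_ra x a) = tens_mul x * a.
Proof.
have hb := mul_bilinear; have hl := tens_ra_bilinear a.
elim/tens_ind: x => [|u v|x y IHx IHy]; rewrite /tens_mul /tens_ra.
- by rewrite (tens_lift0 hl) !(tens_lift0 hb) mul0r.
- by rewrite (tens_lift_tpair hl) !(tens_lift_tpair hb) mulrA.
- by rewrite (tens_liftD hl) !(tens_liftD hb) mulrDl -IHx -IHy.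
Qed.

Fact univ1_la_subproof a (m : univ1) : tens_la a m \in univ1_pred.
Proof. by rewrite inE tens_mul_la (eqP (univ1P m)) mulr0. Qed.
Fact univ1_ra_subproof (m : univ1) a : tens_ra m a \in univ1_pred.
Proof. by rewrite inE tens_mul_ra (eqP (univ1P m)) mul0r. Qed.

Definition univ1_la (a : A) (m : univ1) : univ1 := Univ1 (univ1_la_subproof a m).
Definition univ1_ra (m : univ1) (a : A) : univ1 := Univ1 (univ1_ra_subproof m a).

Fact univ1_d_subproof (a : A) : tpair 1 a - tpair a 1 \in univ1_pred.
Proof.
have hb := mul_bilinear; have lin := tens_lift_linear hb.
rewrite inE /tens_mul -scaleN1r addrC lin !(tens_lift_tpair hb).
by rewrite mul1r mulr1 scaleN1r addNr.
Qed.
Definition univ1_d (a : A) : univ1 := Univ1 (univ1_d_subproof a).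

Lemma univ1_d_linear : linear univ1_d.
Proof.
move=> k a b; apply: val_inj; rewrite /= (tpair_bilinear A A).1 (tpair_bilinear A A).2.
by rewrite scalerBr opprD addrACA.
Qed.

Lemma univ1_d1 : univ1_d 1 = 0.
Proof. by apply: val_inj; rewrite /= subrr. Qed.

Lemma univ1_dM a b : univ1_d (a * b) = univ1_ra (univ1_d a) b + univ1_la a (univ1_d b).
Proof.
apply: val_inj => /=; rewrite /tens_la /tens_ra.
have hl := tens_la_bilinear a; have hr := tens_ra_bilinear b.
rewrite !(linear_add (tens_lift_linear hl)) !(linear_add (tens_lift_linear hr)).
rewrite (linear_opp (tens_lift_linear hl)) (linear_opp (tens_lift_linear hr)).
rewrite !(tens_lift_tpair hl) !(tens_lift_tpair hr) mulr1 mul1r.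
by rewrite addrA subrK.
Qed.

Definition univ_alg := talg univ1_la univ1_ra.

Definition univ_in0 : A -> univ_alg := @talg_in0 _ _ _ univ1_la univ1_ra.
Definition univ_in1 : univ1 -> univ_alg := @talg_in1 _ _ _ univ1_la univ1_ra.

Let hin : tmodel univ1_la univ1_ra univ_in0 univ_in1 := tmodel_in univ1_la univ1_ra.

Let du (a : A) : univ_alg := univ_in1 (univ1_d a).

Let du_linear : linear du.
Proof. by move=> k a b; rewrite /du univ1_d_linear (tmodel_g_linear hin). Qed.

Let du1 : du 1 = 0.
Proof.
rewrite /du univ1_d1; have := linear_scale (tmodel_g_linear hin) 0 0.
by rewrite !scale0r.
Qed.

Let duM a b : du (a * b) = du a * univ_in0 b + univ_in0 a * du b.
Proof.
rewrite /du univ1_dM -[X in univ_in1 (X + _)]scale1r (tmodel_g_linear hin) scale1r.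
by rewrite (tmodel_gl hin) (tmodel_gr hin).
Qed.

(* [d (sum u_i (x) v_i) = sum d u_i . d v_i] on the kernel of multiplication,
   because there [sum u_i (x) v_i = sum u_i . d v_i]. *)
Definition univ_d1 (x : tens A A) : univ_alg :=
  tens_lift (fun u v => univ_in1 (univ1_d u) * univ_in1 (univ1_d v)) x.

Let univ_d1_bilinear : bilinear_map (fun u v => du u * du v).
Proof.
split=> [w k u v|v k u w]; rewrite du_linear.
  by rewrite mulrDl scalerAl.
by rewrite mulrDr scalerAr.
Qed.

Let in_suml_bilinear : bilinear_map (fun u v : A => univ_in0 u * du v).
Proof.
split=> [w k u v|v k u w]; rewrite ?du_linear ?(tmodel_f_linear hin).
  by rewrite mulrDl scalerAl.
by rewrite mulrDr scalerAr.
Qed.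

Let in_sumr_bilinear : bilinear_map (fun u v : A => du u * univ_in0 v).
Proof.
split=> [w k u v|v k u w]; rewrite ?du_linear ?(tmodel_f_linear hin).
  by rewrite mulrDl scalerAl.
by rewrite mulrDr scalerAr.
Qed.

Fact univ1_projl_subproof (x : tens A A) : x - tpair (tens_mul x) 1 \in univ1_pred.
Proof.
have hb := mul_bilinear; have lin := tens_lift_linear hb.
rewrite inE /tens_mul -scaleN1r addrC lin !(tens_lift_tpair hb).
by rewrite mulr1 scaleN1r addNr.
Qed.
Let projl (x : tens A A) := Univ1 (univ1_projl_subproof x).

Fact univ1_projr_subproof (x : tens A A) : tpair 1 (tens_mul x) - x \in univ1_pred.
Proof.
have hb := mul_bilinear; have lin := tens_lift_linear hb.
rewrite inE /tens_mul -scaleN1r addrC lin !(tens_lift_tpair hb).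
by rewrite mul1r scaleN1r addNr.
Qed.
Let projr (x : tens A A) := Univ1 (univ1_projr_subproof x).

Let tens_mulD (x y : tens A A) : tens_mul (x + y) = tens_mul x + tens_mul y.
Proof. exact: (tens_liftD mul_bilinear). Qed.

Let tens_mul0 : tens_mul 0 = 0.
Proof. exact: (tens_lift0 mul_bilinear). Qed.

Let tpairDl u u' v : tpair (u + u') v = tpair u v + tpair u' v :> tens A A.
Proof. exact: (linear_add ((tpair_bilinear A A).1 v)). Qed.

Let tpair0l v : tpair 0 v = 0 :> tens A A.
Proof. exact: (linear_zero ((tpair_bilinear A A).1 v)). Qed.

Let tpairDr u v v' : tpair u (v + v') = tpair u v + tpair u v' :> tens A A.
Proof. exact: (linear_add ((tpair_bilinear A A).2 u)). Qed.

Let tpair0r u : tpair u 0 = 0 :> tens A A.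
Proof. exact: (linear_zero ((tpair_bilinear A A).2 u)). Qed.

Let in1D := linear_add (tmodel_g_linear hin).
Let in10 := linear_zero (tmodel_g_linear hin).

Let tens_mul_tpair u v : tens_mul (tpair u v) = u * v.
Proof. exact: (tens_lift_tpair mul_bilinear). Qed.

Let in_suml x : tens_lift (fun u v => univ_in0 u * du v) x = univ_in1 (projl x).
Proof.
have hb := in_suml_bilinear.
elim/tens_ind: x => [|u v|x y IHx IHy].
- rewrite (tens_lift0 hb) -[LHS]in10; congr univ_in1; apply: val_inj.
  by rewrite /= tens_mul0 tpair0l subr0.
- rewrite (tens_lift_tpair hb) /du -(tmodel_gl hin); congr univ_in1; apply: val_inj.
  have hl := tens_la_bilinear u.
  rewrite /= tens_mul_tpair /tens_la -scaleN1r addrC (tens_lift_linear hl).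
  by rewrite !(tens_lift_tpair hl) mulr1 scaleN1r addrC.
- rewrite (tens_liftD hb) IHx IHy -in1D; congr univ_in1; apply: val_inj.
  by rewrite /= tens_mulD tpairDl opprD addrACA.
Qed.

Let in_sumr x : tens_lift (fun u v => du u * univ_in0 v) x = univ_in1 (projr x).
Proof.
have hb := in_sumr_bilinear.
elim/tens_ind: x => [|u v|x y IHx IHy].
- rewrite (tens_lift0 hb) -[LHS]in10; congr univ_in1; apply: val_inj.
  by rewrite /= tens_mul0 tpair0r subr0.
- rewrite (tens_lift_tpair hb) /du -(tmodel_gr hin); congr univ_in1; apply: val_inj.
  have hr := tens_ra_bilinear v.
  rewrite /= tens_mul_tpair /tens_ra -scaleN1r addrC (tens_lift_linear hr).
  by rewrite !(tens_lift_tpair hr) mul1r scaleN1r addrC.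
- rewrite (tens_liftD hb) IHx IHy -in1D; congr univ_in1; apply: val_inj.
  by rewrite /= tens_mulD tpairDr opprD addrACA.
Qed.

Let d1_la a (m : univ1) :
  univ_d1 (univ1_la a m) = univ_in0 a * univ_d1 m + du a * univ_in1 m.
Proof.
have hb := univ_d1_bilinear; have hs := in_suml_bilinear.
have E : m = projl (univ1_val m).
  by apply: val_inj; rewrite /= (eqP (univ1P m)) tpair0l subr0.
rewrite [X in du a * univ_in1 X]E -in_suml /= /univ_d1 /tens_la.
elim/tens_ind: (univ1_val m) => [|u v|x y IHx IHy].
- by rewrite (tens_lift0 (tens_la_bilinear a)) !(tens_lift0 hb) (tens_lift0 hs) !mulr0 addr0.
- rewrite (tens_lift_tpair (tens_la_bilinear a)) !(tens_lift_tpair hb) (tens_lift_tpair hs).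
  by rewrite -/(du _) -/(du v) duM mulrDl !mulrA addrC.
- rewrite (tens_liftD (tens_la_bilinear a)) !(tens_liftD hb) (tens_liftD hs) IHx IHy.
  by rewrite !mulrDr addrACA.
Qed.

Let d1_ra (m : univ1) a :
  univ_d1 (univ1_ra m a) = univ_d1 m * univ_in0 a - univ_in1 m * du a.
Proof.
have hb := univ_d1_bilinear; have hs := in_sumr_bilinear.
have E : m = - projr (univ1_val m).
  by apply: val_inj; rewrite /= (eqP (univ1P m)) tpair0r sub0r opprK.
rewrite [X in univ_in1 X * du a]E.
rewrite (linear_opp (tmodel_g_linear hin)) mulNr opprK.
rewrite -in_sumr /= /univ_d1 /tens_ra.
elim/tens_ind: (univ1_val m) => [|u v|x y IHx IHy].
- by rewrite (tens_lift0 (tens_ra_bilinear a)) !(tens_lift0 hb) (tens_lift0 hs) !mul0r addr0.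
- rewrite (tens_lift_tpair (tens_ra_bilinear a)) !(tens_lift_tpair hb) (tens_lift_tpair hs).
  by rewrite -/(du _) -/(du u) duM mulrDr !mulrA.
- rewrite (tens_liftD (tens_ra_bilinear a)) !(tens_liftD hb) (tens_liftD hs) IHx IHy.
  by rewrite !mulrDl addrACA.
Qed.

Definition univ_tri0 (a : A) : tri univ_alg :=
  (univ_in0 a, univ_in1 (univ1_d a), univ_in0 a).
Definition univ_tri1 (m : univ1) : tri univ_alg :=
  (- univ_in1 m, univ_d1 m, univ_in1 m).

Let htri : tmodel univ1_la univ1_ra univ_tri0 univ_tri1.
Proof.
split=> [k a b||a b|k x y|a m|m a]; apply: tri_ext; rewrite /= ?mulNr ?mulrN.
- exact: (tmodel_f_linear hin).
- exact: du_linear.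
- exact: (tmodel_f_linear hin).
- exact: (tmodel_f1 hin).
- exact: du1.
- exact: (tmodel_f1 hin).
- exact: (tmodel_fM hin).
- by rewrite -/(du _) duM addrC.
- exact: (tmodel_fM hin).
- by rewrite (tmodel_g_linear hin) opprD scalerN.
- exact: (tens_lift_linear univ_d1_bilinear).
- exact: (tmodel_g_linear hin).
- by rewrite (tmodel_gl hin).
- exact: d1_la.
- exact: (tmodel_gl hin).
- by rewrite (tmodel_gr hin).
- by rewrite d1_ra addrC.
- exact: (tmodel_gr hin).
Qed.

Definition univ_tri (x : univ_alg) : tri univ_alg := talg_lift univ_tri0 univ_tri1 x.
Definition univ_d (x : univ_alg) : univ_alg := (univ_tri x).1.2.
Definition univ_gr (n : nat) : set univ_alg := @talg_gr _ _ _ univ1_la univ1_ra n.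

Lemma univ_d_in0 a : univ_d (univ_in0 a) = univ_in1 (univ1_d a).
Proof. by rewrite /univ_d /univ_tri (talg_lift_in0 htri). Qed.

Let univ_d_in1 m : univ_d (univ_in1 m) = univ_d1 m.
Proof. by rewrite /univ_d /univ_tri (talg_lift_in1 htri). Qed.

Fact univ_d_linear : linear univ_d.
Proof. by move=> k x y; rewrite /univ_d /univ_tri (talg_lift_linear htri). Qed.

Let univ_triM x y : univ_tri (x * y) = univ_tri x * univ_tri y.
Proof. exact: (talg_lift_mul htri). Qed.

Let univ_triD x y : univ_tri (x + y) = univ_tri x + univ_tri y.
Proof. exact: (linear_add (talg_lift_linear htri)). Qed.

Let univ_tri0E : univ_tri 0 = 0.
Proof. exact: (linear_zero (talg_lift_linear htri)). Qed.

Let univ_tri1E : univ_tri 1 = 1.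
Proof. exact: (talg_lift_one htri). Qed.

Let univ_tri_r x : (univ_tri x).2 = x.
Proof.
elim/talg_ind: x => [|x y IHx IHy|w].
- by rewrite univ_tri0E.
- by rewrite univ_triD /= IHx IHy.
elim: w => [|l w IH]; first by rewrite /word_eval big_nil univ_tri1E.
rewrite word_eval_cons univ_triM /= IH; congr (_ * _).
by case: l => [a|m] /=; rewrite /univ_tri ?(talg_lift_in0 htri) ?(talg_lift_in1 htri).
Qed.

Let univ_tri_l n x : univ_gr n x -> (univ_tri x).1.1 = (-1) ^+ n * x.
Proof.
move: x; apply: talg_gr_ind => [|x y IHx IHy|w <-].
- by rewrite univ_tri0E mulr0.
- by rewrite univ_triD /= IHx IHy mulrDr.
elim: w => [|l w IH]; first by rewrite /word_eval big_nil univ_tri1E mulr1.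
rewrite word_eval_cons univ_triM /= IH /word_deg /=.
case: l => [a|m] /=; rewrite /univ_tri ?(talg_lift_in0 htri) ?(talg_lift_in1 htri) /=.
  by rewrite add0n !mulrA; congr (_ * _); apply: commr_sign.
by rewrite exprS mulN1r !mulNr !mulrA; congr (- (_ * _)); apply: commr_sign.
Qed.

Fact univ_d_leibniz n x y : univ_gr n x ->
  univ_d (x * y) = univ_d x * y + (-1) ^+ n * (x * univ_d y).
Proof.
by move=> hx; rewrite /univ_d univ_triM /= (univ_tri_l hx) univ_tri_r addrC mulrA.
Qed.

Let univ_gr_d1 x : univ_gr 2 (univ_d1 x).
Proof.
have hb := univ_d1_bilinear; rewrite /univ_d1.
elim/tens_ind: x => [|u v|x y IHx IHy].
- by rewrite (tens_lift0 hb); apply: talg_gr0.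
- rewrite (tens_lift_tpair hb); apply: (@talg_grM _ _ _ _ _ 1 1); exact: talg_gr_in1.
- by rewrite (tens_liftD hb); apply: talg_grD.
Qed.

Fact univ_d_gr n x : univ_gr n x -> univ_gr n.+1 (univ_d x).
Proof.
move: x; apply: talg_gr_ind => [|x y IHx IHy|w <-].
- by rewrite (linear_zero univ_d_linear); apply: talg_gr0.
- by rewrite (linear_add univ_d_linear); apply: talg_grD.
elim: w => [|l w IH].
  rewrite /word_eval big_nil /univ_d univ_tri1E; exact: talg_gr0.
rewrite word_eval_cons; case: l => [a|m]; rewrite /word_deg /= -/(word_deg _).
  rewrite (univ_d_leibniz _ (talg_gr_in0 _ _ a)) expr0 mul1r; apply: talg_grD.
    rewrite univ_d_in0 add0n -add1n.
    by apply: talg_grM; [apply: talg_gr_in1|apply: talg_gr_word].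
  apply: (@talg_grM _ _ _ _ _ 0) => //; exact: talg_gr_in0.
rewrite (univ_d_leibniz _ (talg_gr_in1 _ _ m)); apply: talg_grD.
  rewrite univ_d_in1 add1n -add2n.
  by apply: talg_grM; [apply: univ_gr_d1|apply: talg_gr_word].
rewrite expr1 mulN1r -scaleN1r; apply: talg_grZ; rewrite add1n -[_.+2]add1n.
apply: talg_grM => //; exact: talg_gr_in1.
Qed.

Let univ_dd_du u : univ_d (univ_in1 (univ1_d u)) = 0.
Proof.
rewrite univ_d_in1 /univ_d1 /=; have hb := univ_d1_bilinear.
rewrite -scaleN1r addrC (tens_lift_linear hb) !(tens_lift_tpair hb).
by rewrite du1 mul0r mulr0 scaler0 addr0.
Qed.

Let univ_dd_in1 m : univ_d (univ_d (univ_in1 m)) = 0.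
Proof.
rewrite univ_d_in1 /univ_d1; have hb := univ_d1_bilinear.
elim/tens_ind: (univ1_val m) => [|u v|x y IHx IHy].
- by rewrite (tens_lift0 hb) (linear_zero univ_d_linear).
- rewrite (tens_lift_tpair hb) (univ_d_leibniz _ (talg_gr_in1 _ _ _)).
  by rewrite !univ_dd_du mul0r !mulr0 addr0.
- by rewrite (tens_liftD hb) (linear_add univ_d_linear) IHx IHy addr0.
Qed.

Fact univ_d_d x : univ_d (univ_d x) = 0.
Proof.
elim/talg_ind: x => [|x y IHx IHy|w].
- by rewrite !(linear_zero univ_d_linear).
- by rewrite !(linear_add univ_d_linear) IHx IHy addr0.
elim: w => [|l w IH].
  by rewrite /word_eval big_nil [univ_d 1]/univ_d univ_tri1E (linear_zero univ_d_linear).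
pose e := word_deg [:: l].
pose x : univ_alg := letter_eval univ_in0 univ_in1 l.
have hx : univ_gr e x.
  by rewrite /x /e; case: (l) => [a|m]; [apply: talg_gr_in0|apply: talg_gr_in1].
have hddx : univ_d (univ_d x) = 0.
  by rewrite /x; case: (l) => [a|m] /=; rewrite ?univ_dd_in1 // univ_d_in0 univ_dd_du.
rewrite word_eval_cons -/x (univ_d_leibniz _ hx) (linear_add univ_d_linear).
rewrite (univ_d_leibniz _ (univ_d_gr hx)) hddx mul0r add0r.
have dsign k y : univ_d ((-1) ^+ k * y) = (-1) ^+ k * univ_d y.
  rewrite -signr_odd; case: odd; rewrite ?expr0 ?expr1 ?mul1r // !mulN1r.
  exact: (linear_opp univ_d_linear).
by rewrite dsign (univ_d_leibniz _ hx) IH !mulr0 addr0 exprS mulN1r mulNr addNr.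
Qed.

Definition univ_dga : dga K :=
  @Dga K univ_alg univ_gr univ_d
    (@talg_gr0 _ _ _ univ1_la univ1_ra) (@talg_grP _ _ _ univ1_la univ1_ra)
    (@talg_gr1 _ _ _ univ1_la univ1_ra) (@talg_grM _ _ _ univ1_la univ1_ra)
    (@talg_gr_sum _ _ _ univ1_la univ1_ra) (@talg_gr_indep _ _ _ univ1_la univ1_ra)
    univ_d_linear univ_d_gr univ_d_leibniz univ_d_d.

End Universal.

(* A quotient of [univ_dga A] by a differential graded ideal is given by a
   surjective morphism, the ideal being its kernel; [dc_quot_ker0] says that the
   degree-zero component of this ideal is zero. *)
Record diff_calculus (K : numFieldType) (A : algType K) := DiffCalculus {
  dc_dga :> dga K;
  dc_quot : univ_dga A -> dc_dga;
  dc_quot_morphism : dga_morphism dc_quot;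
  dc_quot_surj : forall y, exists x, dc_quot x = y;
  dc_quot_ker0 : forall x, dga_gr 0 x -> dc_quot x = 0 -> x = 0 }.

Section Calculus.
Variables (K : numClosedFieldType) (A : algType K).

Record star_algebra (starA : A -> A) : Prop := StarAlgebra {
  starA_conj_linear : forall (k : K) (a b : A),
    starA (k *: a + b) = k^* *: starA a + starA b;
  starA_involutive : forall a, starA (starA a) = a;
  starA_mul : forall a b, starA (a * b) = starA b * starA a }.

(* The canonical identification of [A] with the component of degree 0. *)
Definition dc_in (Omega : diff_calculus A) (a : A) : Omega :=
  dc_quot Omega (univ_in0 a).

Record star_calculus (starA : A -> A) (Omega : diff_calculus A)
    (star : Omega -> Omega) : Prop := StarCalculus {
  star_conj_linear : forall (k : K) (x y : Omega),
    star (k *: x + y) = k^* *: star x + star y;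
  star_gr : forall n (x : Omega), dga_gr n x -> dga_gr n (star x);
  star_involutive : forall x : Omega, star (star x) = x;
  star_in : forall a, star (dc_in Omega a) = dc_in Omega (starA a);
  star_d : forall x : Omega, star (dga_d x) = dga_d (star x);
  star_mul : forall m n (x y : Omega), dga_gr m x -> dga_gr n y ->
    star (x * y) = (-1) ^+ (m * n) * (star y * star x) }.

Record almost_complex (Omega : diff_calculus A) (star J : Omega -> Omega) : Prop :=
  AlmostComplex {
    J_linear : linear J;
    J_gr : forall n (x : Omega), dga_gr n x -> dga_gr n (J x);
    J_derivation : forall x y : Omega, J (x * y) = J x * y + x * J y;
    J_in : forall a, J (dc_in Omega a) = 0;
    J_square : forall x : Omega, dga_gr 1 x -> J (J x) = - x;
    J_star1 : forall x : Omega, dga_gr 1 x -> J (star x) = star (J x) }.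

Definition hodge (Omega : diff_calculus A) (J : Omega -> Omega) (p q : nat) :
    set Omega :=
  [set x : Omega | dga_gr (p + q) x /\ J x = ((p%:R - q%:R) * 'i : K) *: x].

End Calculus.

(* Main.v *)
Require Import Defs.
From mathcomp Require Import all_boot all_order all_algebra.
From mathcomp Require Import boolp classical_sets reals complex.

Import GRing.Theory Num.Theory.
Local Open Scope ring_scope.
Local Open Scope classical_set_scope.

(** The calculus is generated by its components of degrees 0 and 1, where [J]
    commutes with [*] by assumption. If [J] commutes with [*] on two homogeneous
    elements then it does so on their product, since [J] is a derivation of degree
    zero: both terms of [J (xi eta)] get the same sign from [*]. The statement on
    [Omega^{p,q}] follows, as [(p - q) i] is conjugate to [(q - p) i]. *)

Lemma dc_ind (K : numFieldType) (A : algType K) (Omega : diff_calculus A)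
    (P : Omega -> Prop) :
  P 0 -> (forall x y, P x -> P y -> P (x + y)) ->
  (forall a, P (dc_quot Omega (univ_in0 a))) ->
  (forall x, dga_gr 1 x -> P x) ->
  (forall m n x y, dga_gr m x -> dga_gr n y -> P x -> P y -> P (x * y)) ->
  forall x, P x.
Proof.
move=> P0 PD Pin P1 PM x.
(* Lifting to the tensor algebra reduces the claim to words, treated letter by letter. *)
have [u <-] := dc_quot_surj x.
have hq := dc_quot_morphism Omega; have lin := dga_morphism_linear hq.
elim/talg_ind: u => [|u v IHu IHv|w].
- by rewrite (linear_zero lin).
- by rewrite (linear_add lin); apply: PD.
elim: w => [|l w IH].
  (* The empty word is the unit, which comes from [1] in [A]. *)
  rewrite /word_eval big_nil -(tmodel_f1 (tmodel_in (@univ1_la K A) (@univ1_ra K A))).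
  exact: Pin.
(* Words and letters are homogeneous, so [PM] is only needed for homogeneous factors, where [star]
   has a sign rule. *)
have hw := dga_morphism_gr hq (talg_gr_word (@univ1_la K A) (@univ1_ra K A) w).
rewrite word_eval_cons (dga_morphismM hq); case: l => [a|m] /=.
  have ha := dga_morphism_gr hq (talg_gr_in0 (@univ1_la K A) (@univ1_ra K A) a).
  exact: PM ha hw (Pin a) IH.
have hm := dga_morphism_gr hq (talg_gr_in1 (@univ1_la K A) (@univ1_ra K A) m).
exact: PM hm hw (P1 _ hm) IH.
Qed.

Section AlmostComplexStar.
Variables (K : numClosedFieldType) (A : algType K) (starA : A -> A).
Variables (Omega : diff_calculus A) (star J : Omega -> Omega).
Hypotheses (Hstar : star_calculus starA star) (HJ : almost_complex star J).

Lemma starD (x y : Omega) : star (x + y) = star x + star y.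
Proof. by rewrite -[x]scale1r (star_conj_linear Hstar) rmorph1 !scale1r. Qed.

Lemma star0 : star 0 = 0.
Proof. by apply: (addrI (star 0)); rewrite -starD !addr0. Qed.

Lemma starZ (k : K) (x : Omega) : star (k *: x) = k^* *: star x.
Proof. by rewrite -[k *: x]addr0 (star_conj_linear Hstar) star0 addr0. Qed.

Lemma J_star (x : Omega) : J (star x) = star (J x).
Proof.
have linJ := J_linear HJ.
elim/dc_ind: x => [|x y IHx IHy|a|x|m n x y hx hy IHx IHy].
- by rewrite star0 (linear_zero linJ) star0.
- by rewrite starD !(linear_add linJ) starD IHx IHy.
(* Both sides vanish: [star] preserves the image of [A], on which [J] is zero. *)
- by rewrite -/(dc_in Omega a) (star_in Hstar) !(J_in HJ) star0.
- exact: J_star1 HJ x.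
(* The sign is a ring element, not a scalar, so linearity of [J] does not apply to it directly. *)
have Jsign k z : J ((-1) ^+ k * z) = (-1) ^+ k * J z.
  by rewrite -signr_odd !mulr_sign; case: odd => //; rewrite (linear_opp linJ).
rewrite (star_mul Hstar hx hy) Jsign !(J_derivation HJ) starD.
rewrite (star_mul Hstar (J_gr HJ hx) hy) (star_mul Hstar hx (J_gr HJ hy)).
(* As [star] reverses products, the two Leibniz terms appear in opposite orders. *)
by rewrite IHx IHy -mulrDr addrC.
Qed.

Lemma star_hodge (p q : nat) (x : Omega) : hodge J p q x -> hodge J q p (star x).
Proof.
move=> [hx Jx]; split; first by rewrite addnC; apply: (star_gr Hstar).
rewrite J_star Jx starZ; congr (_ *: _).
have conjE : ((p%:R - q%:R) * 'i : K)^* = (q%:R - p%:R) * 'i.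
  by rewrite rmorphM rmorphB !rmorph_nat /= conjCi mulrN -mulNr opprB.
exact: conjE.
Qed.

Lemma star_image_hodge (p q : nat) : star @` hodge J p q = hodge J q p.
Proof.
apply/seteqP; split=> [_ [x hx <-]|x hx]; first exact: star_hodge.
(* Since [star] is an involution, [star x] is a preimage of [x], and the inclusion already proved,
   with [p] and [q] exchanged, places it in [hodge J p q]. *)
by exists (star x); [apply: star_hodge|apply: (star_involutive Hstar)].
Qed.

End AlmostComplexStar.

Theorem proposition2p12 (R : realType) (A : algType R[i])
    (starA : A -> A) (HstarA : star_algebra starA)
    (Omega : diff_calculus A)
    (star : Omega -> Omega) (Hstar : star_calculus starA star)
    (J : Omega -> Omega) (HJ : almost_complex star J) :
  (forall xi : Omega, J (star xi) = star (J xi)) /\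
  (forall p q : nat, star @` hodge J p q = hodge J q p).
Proof.
split=> [x|p q].
- exact: (@J_star _ A starA Omega star J Hstar HJ x).
- exact: (@star_image_hodge _ A starA Omega star J Hstar HJ p q).
Qed.
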